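(* For integers $n \ge 1$ and $m \ge 1$, let $Q_{n,m}$ be the number of distinct quiddities (as ordered $(n+2)$-tuples, with the vertices of the polygon labelled in cyclic order) of $3$-periodic dissections of the convex $(n+2)$-gon into $m$ cells. Then $Q_{n,m}=0$ unless $n \equiv m \pmod 3$, and if $n \equiv m \pmod 3$ then $$Q_{n,m} = \sum_{0 \le s \le (n-m)/3} \frac{n-m-3s+2}{n-s+1}\binom{m+s-2}{s}\binom{n+m-s-1}{m-1},$$ where the sum is over integers $s$ (and is empty, hence $0$, when $m>n$).
   Context: A dissection of a convex polygon is a partition of it into sub-polygons (cells) by a set of pairwise non-crossing diagonals; a dissection is determined by its set of diagonals. The quiddity of a dissection of the $N$-gon with vertices $1,\dots,N$ in cyclic order is the $N$-tuple $(c_1,\dots,c_N)$, where $c_i$ is the number of cells having vertex $i$ as one of their vertices. A dissection is $\ell$-periodic if the number of vertices of every cell is congruent to $3$ modulo $\ell$; in particular it is $3$-periodic if every cell has a number of vertices divisible by $3$. *)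

(* Defs.v *)
(* Combinatorial model of dissections of a convex N-gon
   with vertices 'I_N = {0,...,N-1} in cyclic order. *)
From mathcomp Require Import all_boot all_order all_algebra.
Set Implicit Arguments. Unset Strict Implicit. Unset Printing Implicit Defensive.

Section Dissections.
Variable N : nat.
Implicit Types (a b c : 'I_N) (p q : 'I_N * 'I_N).

(* c lies strictly inside the cyclic (counterclockwise) arc going from a to b *)
Definition cyc_between a b c : bool :=
  let d (x : 'I_N) := (x + N - a) %% N in (0 < d c) && (d c < d b).

Definition side a b : bool :=
  (nat_of_ord b == a.+1 %% N) || (nat_of_ord a == b.+1 %% N).

Definition is_diag p : bool := (p.1 < p.2) && ~~ side p.1 p.2.

Definition cross p q : bool :=
  ((p.1 < q.1 < p.2) && (p.2 < q.2)) || ((q.1 < p.1 < q.2) && (q.2 < p.2)).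

Definition is_dissection (D : {set 'I_N * 'I_N}) : bool :=
  [forall p in D, is_diag p] && [forall p in D, forall q in D, ~~ cross p q].

Definition in_D (D : {set 'I_N * 'I_N}) a b : bool :=
  ((a, b) \in D) || ((b, a) \in D).

Definition consec (C : {set 'I_N}) a b : bool :=
  [&& a \in C, b \in C, a != b & [forall c in C, ~~ cyc_between a b c]].

(* C is (the vertex set of) a cell of D: the sub-polygon conv(C) is bounded by
   sides/diagonals of D and no diagonal of D passes through its interior
   (i.e. no diagonal of D joins two non-consecutive vertices of C). *)
Definition is_cell (D : {set 'I_N * 'I_N}) (C : {set 'I_N}) : bool :=
  [&& 3 <= #|C|,
      [forall a in C, forall b in C, consec C a b ==> (side a b || in_D D a b)] &
      [forall a in C, forall b in C,
         [&& a != b, ~~ consec C a b & ~~ consec C b a] ==> ~~ in_D D a b]].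

Definition cells (D : {set 'I_N * 'I_N}) : {set {set 'I_N}} :=
  [set C : {set 'I_N} | is_cell D C].

Definition quiddity (D : {set 'I_N * 'I_N}) : seq nat :=
  [seq #|[set C in cells D | i \in C]| | i <- enum 'I_N].

Definition three_periodic (D : {set 'I_N * 'I_N}) : bool :=
  [forall C in cells D, 3 %| #|C|].

End Dissections.

Definition Q (n m : nat) : nat :=
  size (undup [seq quiddity D | D <- enum [set D : {set 'I_(n.+2) * 'I_(n.+2)} |
     [&& is_dissection D, three_periodic D & #|cells D| == m]]]).

(* Main.v *)
(**
Encode a quiddity (c_1, ..., c_N) as the word V W^(c_1 - 1) ... V W^(c_N - 1).
Gluing a cell with 3d vertices onto a side other than the base side replaces a
non-initial letter V by W V^(3d-1) W. In PSL(2,Z) = <S, U | S^2 = U^3 = 1> put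
V = U and W = SU: then W V^(3d-1) W = V, and the normal form theorem for the free
product shows that a word beginning with V is the word of a quiddity exactly
when it equals 1. The number of cells is read off the number 2(m-1) of letters W.

Walks in the tree of triangles (the cosets of <U>) are parsed deterministically
by the grammar T -> V | W T T E, E -> V T T E | W, and a closed walk starting
with V is V followed by 3d-1 symbols T. With t and e the generating functions of
T and E (x marking V, y marking W), t = x + y t^2 e and e = y / (1 - x t^2), so
Lagrange inversion yields closed forms for the coefficients of t^j e^i; these
forms are checked against the recurrences given by the first letter of the word.
*)
Require Import Defs.
From mathcomp Require Import all_boot all_order all_algebra.
From mathcomp Require Import zify ring.
Set Implicit Arguments. Unset Strict Implicit. Unset Printing Implicit Defensive.
Import GRing.Theory Num.Theory.

(** * Closed walks in the tree of triangles *)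

(* The letters V and W are [true] and [false]. A state [(p, st)] stands for a
   vertex of the tree: [p] is the position in the current triangle, counted from
   the vertex of entry (from the starting vertex in the base triangle), and [st]
   lists the positions at which the walk resumes in the triangles it entered but
   has not left, the base triangle coming last. *)
Definition state := (nat * seq nat)%type.

Definition step (x : state) (b : bool) : state :=
  if b then (x.1.+1 %% 3, x.2)
  else if (x.1, x.2) is (0, q :: st) then (q, st)
       else (1, x.1.+1 %% 3 :: x.2).

(* The words with [a] letters V and [b] letters W that lead from [x] back to the
   start; the fuel [f] is meant to be [a + b]. *)
Fixpoint closing (f : nat) (x : state) (a b : nat) : seq (seq bool) :=
  if f is f'.+1 then
    (if a is a'.+1 then map (cons true) (closing f' (step x true) a' b) else [::]) ++
    (if b is b'.+1 then map (cons false) (closing f' (step x false) a b') else [::])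
  else if x == (0, [::]) then [:: [::]] else [::].

Lemma closingP f x a b w : f = a + b ->
  (w \in closing f x a b) =
  [&& count id w == a, count negb w == b & foldl step x w == (0, [::])].
Proof.
elim: f x a b w => [|f IH] x a b w /= fE.
  have [-> ->] : a = 0 /\ b = 0 by lia.
  by case: w => [|[] w] /=; rewrite ?andbF; case: ifP.
rewrite mem_cat; case: w => [|[] w] /=.
- have -> : (0 == a) && ((0 == b) && (x == (0, [::]))) = false by lia.
  by case: a {fE} => [|a]; case: b => [|b] //=; apply/negP;
     rewrite ?orbF => /= H; repeat case/orP: H => H; case/mapP: H.
- rewrite [X in _ || X](_ : _ = false); last first.
    by case: b {fE} => // b; apply/mapP => -[].
  rewrite orbF; case: a fE => [|a] fE //.
  by rewrite mem_map; [rewrite IH ?eqSS //; lia | move=> ? ? []].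
- rewrite [X in X || _](_ : _ = false); last first.
    by case: a {fE} => // a; apply/mapP => -[].
  case: b fE => [|b] fE; first by rewrite andbF.
  by rewrite mem_map; [rewrite IH ?eqSS //; lia | move=> ? ? []].
Qed.

Lemma closing_uniq f x a b : uniq (closing f x a b).
Proof.
elim: f x a b => [|f IH] x a b /=; first by case: ifP.
have inj (c : bool) : injective (cons c) by move=> ? ? [].
rewrite cat_uniq; apply/and3P; split.
- by case: a => // a; rewrite map_inj_uniq.
- apply/hasPn => w; case: b => // b /mapP[v _ ->].
  by case: a => // a; apply/mapP => -[].
- by case: b => // b; rewrite map_inj_uniq.
Qed.

(** * Counting the derivations of the grammar *)

Section Counting.
Local Open Scope ring_scope.

(** The binomial coefficient of [n] over [q - 1], set to 0 at [q = 0], where truncated subtraction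
    would give 1. *)
Definition bin_pred (n q : nat) : rat := if q is q'.+1 then 'C(n, q')%:R else 0.

(* [parse_term j i k q] is the number of words derived from j symbols T and i
   symbols E with k uses of T -> W T T E and q uses of E -> V T T E, as given by
   Lagrange inversion; such words have j + k + 3q letters V and i + 2k letters W. *)
Definition parse_term (j i k q : nat) : rat :=
  if k is k'.+1 then
    'C(2 * k' + 2 * q + j + 1, k')%:R / k%:R *
    (j%:R * 'C(i + k' + q, q)%:R + 2 * i%:R * bin_pred (i + k' + q) q)
  else 'C((i + q).-1, q)%:R.

(** The first symbol T is expanded: T -> V leaves [j] symbols T, while T -> W T T E leaves [j + 2]
    of them, one more E, and one use fewer in [k]. Algebraically, this is Pascal's rule combined
    with two absorption identities, [qA] and [XE]. *)
Lemma parse_term_side j i k q :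
  parse_term j.+1 i k q = parse_term j i k q + (if k is k'.+1 then parse_term j.+2 i.+1 k' q else 0).
Proof.
case: k => [|[|k]] /=; first by rewrite addr0.
  by rewrite !bin0 addn0 !divr1 !mul1r -natr1; ring.
have -> : (i.+1 + k + q = i + k.+1 + q)%N by lia.
set A := 'C(_, q)%:R; set B := bin_pred _ _.
have qA : q%:R * A = (i + k.+2)%:R * B.
  rewrite {}/A {}/B /bin_pred; case: q => [|q]; first by rewrite mul0r mulr0.
  rewrite -!natrM; congr (_%:R); rewrite mul_bin_left; congr (_ * _)%N; lia.
have -> : (2 * k.+1 + 2 * q + j.+1 + 1 = (2 * k + 2 * q + j + 3).+1)%N by lia.
have -> : (2 * k.+1 + 2 * q + j + 1 = 2 * k + 2 * q + j + 3)%N by lia.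
have -> : (2 * k + 2 * q + j.+2 + 1 = 2 * k + 2 * q + j + 3)%N by lia.
rewrite binS natrD.
set X := (2 * k + 2 * q + j + 3)%N.
have XE : k.+1%:R * 'C(X, k.+1)%:R = (k + 2 * q + j + 3)%:R * 'C(X, k)%:R :> rat.
  rewrite -!natrM; congr (_%:R); rewrite mul_bin_left; congr (_ * _)%N; rewrite /X; lia.
have k1 : k.+1%:R != 0 :> rat by rewrite pnatr_eq0.
have k2 : k.+2%:R != 0 :> rat by rewrite pnatr_eq0.
have CE : 'C(X, k.+1)%:R = (k + 2 * q + j + 3)%:R * 'C(X, k)%:R / k.+1%:R :> rat.
  by rewrite -XE mulrC mulKf.
rewrite {}CE; clearbody A B; move: k1 k2.
set c := 'C(X, k)%:R; clearbody c.
have -> : (k + 2 * q + j + 3)%:R = k%:R + 2 * q%:R + j%:R + 3 :> rat by rewrite -natrM -!natrD.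
move: qA; rewrite natrD -!(natr1 k.+1) -!(natr1 k) -(natr1 j.+1) -(natr1 j) -(natr1 i).
set kk : rat := k%:R; set qq : rat := q%:R; set ii : rat := i%:R; set jj : rat := j%:R.
move=> qA k1 k2; clearbody kk qq ii jj.
apply/eqP; rewrite -subr_eq0; apply/eqP.
(* The difference of the two sides is a multiple of the relation [qA]. *)
transitivity (c * 2 * (qq * A - (ii + (kk + 1 + 1)) * B) / (kk + 1) / (kk + 1 + 1)).
  by field; rewrite k1 k2.
by rewrite qA subrr mulr0 !mul0r.
Qed.

(** The first symbol E is expanded, by E -> V T T E or by E -> W. *)
Lemma parse_term_entry j i k q :
  parse_term j i.+1 k q =
  (if q is q'.+1 then parse_term j.+2 i.+1 k q' else 0) + parse_term j i k q.
Proof.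
case: k => [|k] /=.
  case: q => [|q]; first by rewrite !bin0 add0r.
  by rewrite !addnS /= binS natrD addrC.
case: q => [|q] /=.
  by rewrite !bin0 !mulr0 !addr0 add0r.
have -> : (2 * k + 2 * q + j.+2 + 1 = 2 * k + 2 * q.+1 + j + 1)%N by lia.
have -> : (i.+1 + k + q.+1 = (i + k + q.+1).+1)%N by lia.
have -> : (i.+1 + k + q = i + k + q.+1)%N by lia.
have -> : bin_pred (i + k + q.+1) q = 'C((i + k + q.+1).+1, q)%:R - 'C(i + k + q.+1, q)%:R.
  case: q => [|q] /=; first by rewrite !bin0 subrr.
  by rewrite binS natrD; ring.
by rewrite binS natrD -!natr1; ring.
Qed.

(** The letter counts determine the rule counts through [b = i + 2k] and [a = j + k + 3q]; the value
    is 0 if these have no solution. *)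
Definition parse_count (j i a b : nat) : rat :=
  if [&& i <= b, ~~ odd (b - i), j + (b - i)./2 <= a & 3 %| a - j - (b - i)./2]%N
  then parse_term j i (b - i)./2 ((a - j - (b - i)./2) %/ 3) else 0.

Lemma parse_countE j i k q a b : a = (j + k + 3 * q)%N -> b = (i + 2 * k)%N ->
  parse_count j i a b = parse_term j i k q.
Proof.
move=> -> ->; rewrite /parse_count.
have -> : (i + 2 * k - i)%N = k.*2 by lia.
rewrite odd_double doubleK.
have -> : (j + k + 3 * q - j - k = q * 3)%N by lia.
by rewrite dvdn_mull // mulnK // !leq_addr.
Qed.

Variant parse_count_spec j i a b : rat -> Type :=
| ParseCountTerm k q of a = (j + k + 3 * q)%N & b = (i + 2 * k)%N :
    parse_count_spec j i a b (parse_term j i k q)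
| ParseCountZero of (forall k q, a = (j + k + 3 * q)%N -> b = (i + 2 * k)%N -> False) :
    parse_count_spec j i a b 0.

Lemma parse_countP j i a b : parse_count_spec j i a b (parse_count j i a b).
Proof.
rewrite /parse_count; case: ifP => H.
  apply: ParseCountTerm; lia.
apply: ParseCountZero => k q aE bE; move/negP: H; apply.
have -> : (b - i)%N = k.*2 by lia.
rewrite odd_double doubleK.
have -> : (a - j - k = q * 3)%N by lia.
by rewrite dvdn_mull //; lia.
Qed.

Lemma parse_count_side j i a b : parse_count j.+1 i a b =
  (if a is a'.+1 then parse_count j i a' b else 0) +
  (if b is b'.+1 then parse_count j.+2 i.+1 a b' else 0).
Proof.
case: (parse_countP j.+1 i a b) => [k q aE bE|H].
  rewrite parse_term_side; case: a aE => [|a] aE; first by lia.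
  rewrite (@parse_countE j i k q) //; last lia; congr (_ + _).
  case: k aE bE => [|k] aE bE.
    case: b bE => // b bE; case: parse_countP => // k' q' *; lia.
  by case: b bE => [|b] bE; [lia | rewrite (@parse_countE _ _ k q) //; lia].
rewrite [X in X + _](_ : _ = 0) ?[X in _ + X](_ : _ = 0) ?addr0 //.
  by case: b H => // b H; case: parse_countP => // k q aE bE; case: (H k.+1 q); lia.
by case: a H => // a H; case: parse_countP => // k q aE bE; case: (H k q); lia.
Qed.

Lemma parse_count_entry j i a b : parse_count j i.+1 a b =
  (if a is a'.+1 then parse_count j.+2 i.+1 a' b else 0) +
  (if b is b'.+1 then parse_count j i a b' else 0).
Proof.
case: (parse_countP j i.+1 a b) => [k q aE bE|H].
  rewrite parse_term_entry; case: b bE => [|b] bE; first by lia.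
  rewrite (@parse_countE j i k q) //; last lia; congr (_ + _).
  case: q aE bE => [|q] aE bE.
    case: a aE => // a aE; case: parse_countP => // k' q' *; lia.
  by case: a aE => [|a] aE; [lia | rewrite (@parse_countE _ _ k q) //; lia].
rewrite [X in X + _](_ : _ = 0) ?[X in _ + X](_ : _ = 0) ?addr0 //.
  by case: b H => // b H; case: parse_countP => // k q aE bE; case: (H k q); lia.
by case: a H => // a H; case: parse_countP => // k q aE bE; case: (H k q.+1); lia.
Qed.

Lemma parse_count00 a b : parse_count 0 0 a b = ((a == 0%N) && (b == 0%N))%:R.
Proof.
case: parse_countP => [[|k] q aE bE|H].
(* The coefficient ['C(q.-1, q)] is 1 at [q = 0], by truncation, and 0 elsewhere. *)
- rewrite /= add0n; case: q aE => [|q] aE; first by rewrite bin0 aE bE.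
  by rewrite bin_small //; case: a aE => // *; lia.
- rewrite /parse_term mulr0 !mul0r addr0 mulr0; case: b bE => [|b] bE; first by lia.
  by rewrite andbF.
- by case: a b H => [|a] [|b] // H; case: (H 0 0)%N.
Qed.

(** * Closed walks as derivations *)

(** The symbols T still to be parsed to reach position 0 in every open triangle, base included. Each
    stack entry adds one symbol E, the exit from the triangle entered. *)
Definition pending_sides (x : state) : nat := sumn [seq ((3 - p) %% 3)%N | p <- x.1 :: x.2].

Definition small_state (x : state) := (x.1 < 3)%N && all (fun p => p < 3)%N x.2.

Lemma small_state_step x b : small_state x -> small_state (step x b).
Proof.
case: x b => p st [] /= /andP[/= hp hst]; rewrite /small_state /=.
  by rewrite ltn_mod hst.
case: p hp => [|p] hp; last by rewrite /= ltn_mod.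
by case: st hst => [|q st].
Qed.

(* [d] is the number of remaining turns around the base triangle. *)
Lemma size_closing f x a b B : f = (a + b)%N -> small_state x -> (a < 3 * B)%N ->
  (size (closing f x a b))%:R =
  \sum_(d < B) parse_count (pending_sides x + 3 * d) (size x.2) a b.
Proof.
elim: f x a b B => [|f IH] x a b B fE xs aB.
  have [-> ->] : a = 0%N /\ b = 0%N by lia.
  case: B aB => [|B] aB; first by lia.
  rewrite big_ord_recl muln0 addn0 big1 ?addr0; last first.
    by move=> d _; rewrite lift0; case: parse_countP => // k q aE; exfalso; lia.
  case: x xs => p [|q st] /andP[/= p3 _]; last first.
    by rewrite xpair_eqE andbF /=; case: parse_countP => // k q' _ bE; exfalso; lia.
  by case: p p3 => [|[|[|p]]].
rewrite /= size_cat natrD.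
have -> : (size (if a is a'.+1 then map (cons true) (closing f (step x true) a' b) else [::]))%:R
   = \sum_(d < B) (if a is a'.+1
       then parse_count (pending_sides (step x true) + 3 * d) (size x.2) a' b else 0) :> rat.
  case: a fE aB => [|a] fE aB; first by rewrite big1.
  by rewrite size_map (IH _ _ _ B) ?small_state_step //; lia.
have -> : (size (if b is b'.+1 then map (cons false) (closing f (step x false) a b') else [::]))%:R
   = \sum_(d < B) (if b is b'.+1
       then parse_count (pending_sides (step x false) + 3 * d) (size (step x false).2) a b' else 0) :> rat.
  case: b fE aB => [|b] fE aB; first by rewrite big1.
  by rewrite size_map (IH _ _ _ B) ?small_state_step //; lia.
case: x xs => p st /andP[/= p3 st3]; case: p p3 => [|p] p3.
  case: st st3 => [|q st] st3 /=; last first.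
    rewrite -big_split; apply: eq_bigr => d _ /=; rewrite parse_count_entry.
    by congr (_ + _); case: a fE aB.
  case: B aB => [|B] aB; first by lia.
  (* At the start with letters left, no turn is impossible, so [d = 0] contributes 0. A later turn
     [d + 1] begins by expanding one of its 3d+3 symbols T; the top terms on the left vanish because
     they need more than [a] letters V. *)
  rewrite [RHS]big_ord_recl /= /pending_sides /= parse_count00.
  have -> : (a == 0%N) && (b == 0%N) = false by lia.
  rewrite add0r 2!(big_ord_recr B) /=.
  rewrite [X in _ + X + _](_ : _ = 0) ?[X in _ + (_ + X)](_ : _ = 0) ?addr0.
  - rewrite -big_split; apply: eq_bigr => d _ /=.
    have -> : (0 + 0 + 3 * bump 0 d = (3 * d + 2).+1)%N by rewrite /bump; lia.
    rewrite parse_count_side; congr (_ + _).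
      by case: a {fE aB} => // a; congr (parse_count _ _ _ _); lia.
    by case: b {fE} => // b; congr (parse_count _ _ _ _); lia.
  - by case: b {fE} => // b; case: parse_countP => // k q; lia.
  - by case: a fE aB => // a fE aB; case: parse_countP => // k q; lia.
rewrite -big_split; apply: eq_bigr => d _ /=.
rewrite /pending_sides /=.
set w := sumn _.
have -> : ((3 - p.+1) %% 3 + w + 3 * d = ((3 - p.+2 %% 3) %% 3 + w + 3 * d).+1)%N.
  by case: p p3 => [|[|]].
by rewrite parse_count_side; congr (_ + _).
Qed.

(* The words start in state 1: the initial letter V has already been read. *)
Definition closed_count (n m : nat) := size (closing (n + 1 + 2 * m) (1%N, [::]) (n + 1) (2 * m)).

(** Parsing 3d+2 symbols T with [m] uses of T -> W T T E makes the number [n + 1] of letters V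
    congruent to [m + 2] modulo 3. *)
Lemma closed_count0 n m : n != m.+1 %[mod 3] -> closed_count n m = 0%N.
Proof.
move=> nm; apply/eqP; rewrite -(@pnatr_eq0 rat) (size_closing (B := n.+1)) //; last lia.
rewrite big1 // => d _; case: parse_countP => // k q; rewrite /pending_sides /=; move/eqP: nm; lia.
Qed.

Lemma closed_countE n m : n = m.+1 %[mod 3] ->
  (closed_count n m)%:R = \sum_(0 <= s < n.+1 | (m.+1 + 3 * s <= n)%N)
         ((n - m.+1 - 3 * s + 2)%N%:R / (n - s + 1)%N%:R
          * ('C(m.+1 + s - 2, s))%:R * ('C(n + m.+1 - s - 1, m.+1 - 1))%:R) :> rat.
Proof.
move=> nm; rewrite (size_closing (B := n.+1)) //; last lia.
rewrite big_mkord.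
have [nltm|mlen] := ltnP n m.+1.
  rewrite big1 => [|d _]; last by case: parse_countP => // k q; rewrite /pending_sides /=; lia.
  by rewrite big_pred0 // => s; lia.
pose M := ((n - m.+1) %/ 3)%N.
have nE : n = (m.+1 + 3 * M)%N by rewrite /M; lia.
rewrite [LHS](bigID (fun d : 'I_n.+1 => (d <= M)%N)) /= [X in _ + X]big1 ?addr0; last first.
  by move=> d dM; case: parse_countP => // k q; rewrite /pending_sides /=; lia.
rewrite [RHS](eq_bigl (fun s : 'I_n.+1 => (s <= M)%N)); last by move=> s; lia.
(* The index [s] is the number of uses of E -> V T T E; the letter count forces [s = M - d] when [d]
   turns remain. *)
rewrite [LHS](reindex_onto (fun d : 'I_n.+1 => inord (M - d)) (fun d : 'I_n.+1 => inord (M - d))); last first.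
  move=> d dM; apply/val_inj; rewrite /= !inordK //; lia.
apply: eq_big => [s|s].
  have [sM|sM] := leqP s M.
    have H : (nat_of_ord (@inord n (M - s)) = M - s)%N by rewrite inordK //; lia.
    rewrite H leq_subr; apply/eqP/val_inj; rewrite /= inordK; lia.
  apply/negP => /andP[_ /eqP/(congr1 val)].
  have H : (nat_of_ord (@inord n (M - s)) = M - s)%N by rewrite inordK //; lia.
  rewrite /= H inordK; lia.
move=> /andP[_ /eqP/(congr1 val)] /=; move: (ltn_ord s) => sn H.
have sM : (s <= M)%N.
  move: H; have H : (nat_of_ord (@inord n (M - s)) = M - s)%N by rewrite inordK //; lia.
  rewrite /= H inordK; lia.
rewrite inordK; last lia.
rewrite (@parse_countE _ _ m s); [|by rewrite /pending_sides /=; lia|lia].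
clearbody M; case: m nE {nm mlen H} => [|m] nE.
  (* With one cell only [s = 0] contributes; there [1 + s - 2] truncates to 0 and the quotient is
     1. *)
  rewrite /= add0n; case: (nat_of_ord s) nE => [|t] nE.
    rewrite !bin0 !mulr1.
    have -> : (n - 1 - 3 * 0 + 2 = n - 0 + 1)%N by lia.
    by rewrite divff // pnatr_eq0; lia.
  have -> : (1 + t.+1 - 2 = t)%N by lia.
  by rewrite /= (bin_small (ltnSn t)) mulr0n mulr0 mul0r.
rewrite /parse_term mulr0 mul0r addr0 add0n.
have -> : (pending_sides (1%N, [::]) + 3 * (M - s) = n - m.+2 - 3 * s + 2)%N.
  by rewrite /pending_sides /=; lia.
have -> : (2 * m + 2 * s + (n - m.+2 - 3 * s + 2) + 1 = n + m.+2 - s - 1)%N by lia.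
have -> : (m.+2 + s - 2 = m + s)%N by lia.
set X := (n + m.+2 - s - 1)%N.
(* Absorption trades the denominator [m.+1] of [parse_term] for [n - s + 1]. *)
have XE : m.+1%:R * 'C(X, m.+1)%:R = (n - s + 1)%:R * 'C(X, m)%:R :> rat.
  rewrite -!natrM; congr (_%:R); rewrite mul_bin_left; congr (_ * _)%N; rewrite /X; lia.
have m1 : m.+1%:R != 0 :> rat by rewrite pnatr_eq0.
have n1 : (n - s + 1)%:R != 0 :> rat by rewrite pnatr_eq0; lia.
have -> : 'C(X, m)%:R = m.+1%:R * 'C(X, m.+1)%:R / (n - s + 1)%:R :> rat.
  by rewrite XE mulrC mulKf.
have -> : (m.+2 - 1 = m.+1)%N by lia.
move: m1 n1; set u := m.+1%:R; set v := (n - s + 1)%:R; clearbody u v => m1 n1.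
by field; rewrite m1 n1.
Qed.

End Counting.

(** * Words of quiddities *)

(** Quiddities built cell by cell: [EarGlue] attaches a cell with 3d+3 vertices, 3d+1 of them new.
    Only sides between neighbours in the list are used, never the base side from the last vertex to
    the first. *)
Inductive ear_seq : nat -> seq nat -> Prop :=
| EarRoot d : ear_seq 1 (nseq (3 * d.+1) 1)
| EarGlue k d s1 a b s2 : ear_seq k (s1 ++ a :: b :: s2) ->
    ear_seq k.+1 (s1 ++ a.+1 :: nseq (3 * d).+1 1 ++ b.+1 :: s2).

Lemma ear_seq_size k s : ear_seq k s -> 3 <= size s.
Proof.
elim=> [d|{}k d s1 a b s2 _]; first by rewrite size_nseq; lia.
by rewrite !size_cat /= !size_cat /= size_nseq; lia.
Qed.

Lemma ear_seq_pos k s : ear_seq k s -> all (leq 1) s.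
Proof.
elim=> [d|{}k d s1 a b s2 _]; first by rewrite all_nseq orbT.
by rewrite !all_cat /= !all_cat /= all_nseq /= orbT => /and4P[-> _ _ ->].
Qed.

Definition word (s : seq nat) : seq bool :=
  flatten [seq true :: nseq c.-1 false | c <- s].

(* The first component counts the letters W that precede the first V. *)
Definition unword (w : seq bool) : nat * seq nat :=
  foldr (fun b x => if b : bool then (0, x.1.+1 :: x.2) else (x.1.+1, x.2)) (0, [::]) w.

Lemma word_cat s t : word (s ++ t) = word s ++ word t.
Proof. by rewrite /word map_cat flatten_cat. Qed.

Lemma word_cons c s : word (c :: s) = true :: nseq c.-1 false ++ word s.
Proof. by []. Qed.

Lemma word_nseq1 n : word (nseq n 1) = nseq n true.
Proof. by elim: n => //= n <-. Qed.

Lemma nseq_shift (T : Type) n (x : T) s : nseq n x ++ x :: s = x :: nseq n x ++ s.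
Proof. by elim: n => //= n ->. Qed.

Lemma word_adjacent s1 a b s2 : word (s1 ++ a.+1 :: b.+1 :: s2) =
  (word s1 ++ true :: nseq a false) ++ true :: nseq b false ++ word s2.
Proof. by rewrite word_cat -catA. Qed.

(** Compared with [word_adjacent], gluing replaces the letter V that opens the block of [b] by W
    V^(3d+2) W. *)
Lemma word_glue s1 a d b s2 :
  word (s1 ++ a.+2 :: nseq (3 * d).+1 1 ++ b.+2 :: s2) =
  (word s1 ++ true :: nseq a false) ++
    false :: nseq (3 * d).+2 true ++ false :: nseq b false ++ word s2.
Proof.
by rewrite word_cat word_cons word_cat word_nseq1 word_cons -catA /= !nseq_shift.
Qed.

Lemma wordK s : all (leq 1) s -> unword (word s) = (0, s).
Proof.
elim: s => //= c s IH /andP[c1 /IH].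
rewrite /word /= /unword foldr_cat -/(unword _) => ->.
have -> : foldr (fun (b : bool) (x : nat * seq nat) => if b then (0, x.1.+1 :: x.2)
   else (x.1.+1, x.2)) (0, s) (nseq c.-1 false) = (c.-1, s).
  by elim: (c.-1) => //= k ->.
by rewrite /= prednK.
Qed.

Lemma unwordK w : nseq (unword w).1 false ++ word (unword w).2 = w.
Proof. by elim: w => // -[] w IH; rewrite -[in RHS]IH. Qed.

Lemma unword_pos w : all (leq 1) (unword w).2.
Proof. by elim: w => // -[]. Qed.

(** The default [false] rules out the empty word; a first letter V means that no W is left over in
    front. *)
Lemma word_unword w : head false w -> word (unword w).2 = w.
Proof.
move=> hw; have := unwordK w.
by case: (unword w).1 => // k; case: w hw => // -[].
Qed.

Lemma count_word s : all (leq 1) s ->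
  count id (word s) = size s /\ count negb (word s) + size s = sumn s.
Proof.
elim: s => //= c s IH /andP[c1 /IH [h1 h2]].
rewrite /word /= !count_cat !count_nseq /= -/(word s) h1; split; lia.
Qed.

(** Both ends of each diagonal are counted once more than on the bare polygon. Hence the word has
    [2(k - 1)] letters W. *)
Lemma sumn_ear_seq k s : ear_seq k s -> sumn s + 2 = size s + 2 * k.
Proof.
elim=> [d|{}k d s1 a b s2 _]; first by rewrite sumn_nseq size_nseq; lia.
by rewrite !(sumn_cat, size_cat) /= !(sumn_cat, size_cat) /= sumn_nseq size_nseq; lia.
Qed.

(** * Walks of words and the relation W V^(3d+2) W = V *)

Definition run := foldl step.

Lemma run_cat x u v : run x (u ++ v) = run (run x u) v.
Proof. exact: foldl_cat. Qed.

Lemma run_cons x b w : run x (b :: w) = run (step x b) w.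
Proof. by []. Qed.

Lemma run_true p st k : p < 3 -> run (p, st) (nseq k true) = ((p + k) %% 3, st).
Proof.
elim: k p => [|k IH] p p3; first by rewrite addn0 modn_small.
by rewrite run_cons IH ?ltn_mod // modnDml addSnnS.
Qed.

(* Outside the base triangle the walk only pushes [p + 1] when [p <> 0], for at
   [p = 0] the letter W leaves the triangle. *)
Definition reduced (x : state) :=
  [&& x.1 < 3, all (fun p => p < 3) x.2 & all (fun p => p != 1) (belast 0 x.2)].

Lemma reduced_step x b : reduced x -> reduced (step x b).
Proof.
case: x b => p st [] /= /and3P[/= hp hst hr]; rewrite /reduced /=.
  by rewrite ltn_mod hst.
case: p hp => [|p] hp /=.
  case: st hst hr => [|q [|r st]] //= /andP[q3 st3] /andP[_ ->].
  by rewrite q3 st3.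
rewrite ltn_mod hst /=.
by case: st hst hr => [|q st] //= _ ->; case: p hp => [|[|]].
Qed.

(** If the first W enters a triangle, the letters V bring the walk back to its entry and the second
    W leaves it. If the first W leaves to position [q], the second one starts from [q + 2]; it
    enters the same triangle again unless [q = 1] above the base, which [reduced] excludes. *)
Lemma run_ear x d : reduced x ->
  run x (false :: nseq (3 * d).+2 true ++ [:: false]) = step x true.
Proof.
case: x => p st xr; rewrite run_cons run_cat.
have [p3 st3 str] : [/\ p < 3, all (fun p => p < 3) st
                       & all (fun p => p != 1) (belast 0 st)] by apply/and3P.
have e1 : (1 + (3 * d).+2) %% 3 = 0 by lia.
case: p p3 {xr} => [|p] p3; last by rewrite run_true // e1.
case: st st3 str => [|q st] st3 str; first by rewrite run_true // e1.
have /andP[q3 _] : (q < 3) && all (fun p => p < 3) st := st3; rewrite run_true //.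
have -> : (q + (3 * d).+2) %% 3 = (q + 2) %% 3 by lia.
case: st {st3} str => [|r st] str; first by case: q q3 {str} => [|[|[|]]].
by move: str => /=; case: q q3 => [|[|[|]]].
Qed.

Lemma reduced_run x w : reduced x -> reduced (run x w).
Proof. by elim: w x => //= b w IH x /(reduced_step b)/IH. Qed.

Lemma run_glue x u d v : reduced x ->
  run x (u ++ false :: nseq (3 * d).+2 true ++ false :: v) = run x (u ++ true :: v).
Proof.
move=> xr; rewrite run_cat -cat_rcons -cats1 -!cat_cons run_cat run_ear ?reduced_run //.
by rewrite run_cat.
Qed.

Definition origin : state := (0, [::]).

(** The root word turns [d + 1] times around the base triangle, and gluing does not change where a
    walk ends. *)
Lemma ear_seq_run k s : ear_seq k s -> run origin (word s) = origin.
Proof.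
elim=> [d|{}k d s1 a b s2 H IH].
  by rewrite word_nseq1 run_true // add0n; congr (_, _); lia.
move: (ear_seq_pos H) IH; rewrite all_cat /= => /and4P[_].
case: a b {H} => [|a] [|b] // _ _ _; rewrite word_adjacent word_glue.
by rewrite run_glue.
Qed.

(* The normal form argument: between two letters W, a number of letters V other
   than 2 mod 3 makes the second W push again, so the walk cannot come back. *)
Lemma ear_in_run k p st w : p = k %% 3 -> 0 < k -> size (run (p, st) w).2 < size st ->
  exists u d v, false :: nseq k.-1 true ++ w = u ++ false :: nseq (3 * d).+2 true ++ false :: v.
Proof.
elim: w k p st => [|[] w IH] k p st pE k0 /=; first by rewrite ltnn.
  move=> H; have [||u [d [v E]]] := IH k.+1 (p.+1 %% 3) st _ _ H; [lia|by []|].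
  exists u, d, v; rewrite -E; congr (_ :: _).
  by case: k k0 {pE E H} => // k _; rewrite /= nseq_shift.
case: p pE => [|p] pE.
  (* Here [k] is a positive multiple of 3, so the [k - 1] letters V between the two letters W number
     3d+2. *)
  move=> _; exists [::], (k %/ 3).-1, w => /=; congr (_ :: _).
  by have -> : k.-1 = (3 * (k %/ 3).-1).+2 by lia.
(* This W opens a further triangle, which must be left as well; the search restarts there. *)
move=> H; have [||u [d [v E]]] := IH 1 1 (p.+2 %% 3 :: st) _ _ (ltnW H) => //.
exists (false :: nseq k.-1 true ++ u), d, v.
by rewrite /= -catA -E.
Qed.

(** Undoing the relation on words is undoing a gluing on sequences; since [u] begins with V, there
    is a vertex to the left of the glued side. *)
Lemma unword_glue u d v : head false u -> exists s1 a b s2,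
  (unword (u ++ true :: v)).2 = s1 ++ a :: b :: s2 /\
  (unword (u ++ false :: nseq (3 * d).+2 true ++ false :: v)).2 =
    s1 ++ a.+1 :: nseq (3 * d).+1 1 ++ b.+1 :: s2.
Proof.
move=> hu.
have uE := word_unword hu; have := unword_pos u.
case/lastP: (unword u).2 uE => [|s1 a] uE; first by move: hu; rewrite -uE.
have [b [s2 [vE vp]]] : exists b s2, true :: v = word (b :: s2) /\ all (leq 1) (b :: s2).
  have := @word_unword (true :: v) isT; have := unword_pos (true :: v).
  by case: (unword (true :: v)).2 => // b s2 p <-; exists b, s2.
rewrite all_rcons => /andP[a1 s1p]; move: vp => /= /andP[b1 s2p].
exists s1, a, b, s2; split.
  by rewrite -uE vE -word_cat cat_rcons wordK // all_cat /= s1p a1 b1.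
case: a a1 uE => // a _ uE; case: b b1 vE => // b _ [vE].
have -> : u = word s1 ++ true :: nseq a false by rewrite -uE -cats1 word_cat /word /= cats0.
rewrite vE -word_glue wordK // all_cat s1p /= all_cat all_nseq orbT; exact: s2p.
Qed.

(** Induction on the length: a closed word without W is a root, and any other contains some W
    V^(3d+2) W, which is contracted to V while the initial V is kept. *)
Lemma run_ear_seq w : head false w -> run origin w = origin ->
  exists k, ear_seq k (unword w).2.
Proof.
have [n] := ubnP (size w); elim: n w => // n IH w szw hw rw.
have [/all_pred1P|] := boolP (all (pred1 true) w).
  move: rw hw => + + wE; rewrite {}wE; set l := size w => rw hw.
  rewrite -word_nseq1 wordK ?all_nseq ?orbT //.
  move: rw hw; rewrite run_true // add0n => -[l3].
  case: l l3 => // l l3 _; exists 1.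
  have -> : l.+1 = 3 * (l.+1 %/ 3).-1.+1 by lia.
  exact: EarRoot.
rewrite -has_predC => hf.
have [l [y wE]] : exists l y, w = nseq l true ++ false :: y.
  elim: w hf {IH szw hw rw} => //= -[] w IH /=; last by exists 0, w.
  by move=> /IH[l [y ->]]; exists l.+1, y.
have l0 : 0 < l by case: l wE hw => [->|].
move: rw; rewrite wE run_cat run_true // add0n -[run _ (false :: y)]/(run (step _ _) y).
have -> : step (l %% 3, [::]) false = (1, [:: (l %% 3).+1 %% 3]).
  by rewrite /step /=; case: (l %% 3).
(* After the first W the stack has height 1, and it must be empty at the end. *)
move=> ry; have [|||u [d [v]]] := @ear_in_run 1 1 [:: (l %% 3).+1 %% 3] y; rewrite ?ry //= => yE.
rewrite yE catA.
set x := nseq l true ++ u.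
have hx : head false x by rewrite /x; case: l l0 {wE ry x}.
have [s1 [a [b [s2 [e1 e2]]]]] := unword_glue d v hx.
rewrite e2.
have [|||k] := IH (x ++ true :: v).
- move: szw; rewrite wE yE !size_cat /= !size_cat /= size_nseq; lia.
- by case: (x) hx.
- rewrite -(@run_glue _ _ d) // -catA -yE run_cat run_true // add0n.
  by rewrite -[run _ (false :: y)]/(run (step _ _) y) /step /=; case: (l %% 3) ry.
by rewrite e1 => /EarGlue H; exists k.+1.
Qed.

(** * Dissections of sub-polygons and ears *)

(** [cyc_between] in terms of order alone, so that [lia] applies. *)
Definition arc (a b c : nat) : bool :=
  (a < c < b) || (b < a) && ((a < c) || (c < b)).

Lemma arc_lt a b c : a < b -> arc a b c = (a < c < b).
Proof. by move=> ab; rewrite /arc; lia. Qed.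

Lemma arc_gt a b c : b < a -> arc a b c = (a < c) || (c < b).
Proof. by move=> ab; rewrite /arc; lia. Qed.

Lemma arc_eq a c : arc a a c = false.
Proof. by rewrite /arc ltnn orbF; lia. Qed.

Lemma arcN_rev a b c : a != b -> c != a -> c != b -> ~~ arc a b c -> arc b a c.
Proof.
case: (ltngtP a b) => // ab; first by rewrite (arc_lt _ ab) (arc_gt _ ab); lia.
by rewrite (arc_gt _ ab) (arc_lt _ ab); lia.
Qed.

(** For the polygon left after cutting off an ear: a gap over a removed vertex is the cut itself.
    [arc_outside] is the counterpart for the ear. *)
Lemma arc_over i j a b c : i < c < j -> arc a b c -> ~~ arc a b i -> ~~ arc a b j ->
  ~~ (i < a < j) -> ~~ (i < b < j) -> a = i /\ b = j.
Proof.
by case: (ltngtP a b) => [ab|ab|->];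
   [rewrite !(arc_lt _ ab)|rewrite !(arc_gt _ ab)|rewrite !arc_eq]; lia.
Qed.

Lemma arc_outside i j a b c : i < j -> i <= a <= j -> i <= b <= j -> ~~ (i <= c <= j) ->
  arc a b c -> ~~ arc a b i -> ~~ arc a b j -> a = j /\ b = i.
Proof.
by case: (ltngtP a b) => [ab|ab|->];
   [rewrite !(arc_lt _ ab)|rewrite !(arc_gt _ ab)|rewrite !arc_eq]; lia.
Qed.

(** A chord with no end strictly inside the ear cannot cut off [y] without [x]. *)
Lemma arc_avoid i j a b x y : i < x < j -> i <= y <= j ->
  ~~ (i < a < j) -> ~~ (i < b < j) -> arc a b y -> arc a b x.
Proof.
by case: (ltngtP a b) => [ab|ab|->];
   [rewrite !(arc_lt _ ab)|rewrite !(arc_gt _ ab)|rewrite !arc_eq]; lia.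
Qed.

(** The conditionals are cyclic distances: [a] is the nearest candidate before [y] and [b] the
    nearest after it. *)
Lemma arc_gap N a b c y : a != y -> b != y -> c != y -> a < N -> b < N -> c < N -> y < N ->
  (if a < y then y - a else y + N - a) <= (if c < y then y - c else y + N - c) ->
  (if b < y then b + N - y else b - y) <= (if c < y then c + N - y else c - y) ->
  (if b < y then b + N - y else b - y) <= (if a < y then a + N - y else a - y) ->
  (if a < y then y - a else y + N - a) <= (if b < y then y - b else y + N - b) ->
  (c == a) || ~~ arc a b c && ((a != b) && arc a b y).
Proof.
move=> ay bY cy aN bN cN yN.
case: (ltngtP a b) => [ab|ab|<-]; [rewrite !(arc_lt _ ab)|rewrite !(arc_gt _ ab)|rewrite !arc_eq].
all: by case: (ltnP a y); try case: (ltnP b y); case: (ltnP c y); lia.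
Qed.

(** * Polygons on subsets of the vertices *)

Section SubPolygons.
Variable N : nat.
Implicit Types (a b c i j x y : 'I_N) (C S : {set 'I_N}) (D : {set 'I_N * 'I_N}).

Lemma cyc_betweenE a b c : cyc_between a b c = arc a b c.
Proof.
have dE x : (x + N - a) %% N = if a <= x then x - a else x + N - a.
  move: (ltn_ord a) (ltn_ord x) => ha hx; case: leqP => h.
    have -> : x + N - a = (x - a) + N by lia.
    by rewrite modnDr modn_small //; lia.
  by rewrite modn_small //; lia.
rewrite /cyc_between /arc !dE; move: (ltn_ord a) (ltn_ord b) (ltn_ord c).
by case: (leqP a c); case: (leqP a b); lia.
Qed.

Lemma consecP C a b :
  reflect [/\ a \in C, b \in C, a != b & forall c, c \in C -> ~~ arc a b c] (consec C a b).
Proof.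
apply: (iffP and4P) => -[aC bC ab H]; split => //.
  by move=> c cC; rewrite -cyc_betweenE; move/forall_inP: H; apply.
by apply/forall_inP => c cC; rewrite cyc_betweenE H.
Qed.

Lemma neq_ord a b : (a != b) = (a != b :> nat).
Proof. by []. Qed.

Lemma third_vertex C a b : 2 < #|C| -> exists c, [/\ c \in C, c != a & c != b].
Proof.
move=> C3; have : 0 < #|C :\ a :\ b|.
  move: C3; rewrite (cardsD1 a) (cardsD1 b (C :\ a)).
  by case: (a \in C); case: (b \in C :\ a); case: #|_ :\ b|.
by case/card_gt0P => c; rewrite !inE => /and3P[? ? ?]; exists c.
Qed.

Lemma consec_opp C S a b : 2 < #|C| -> C \subset S -> consec C a b -> ~~ consec S b a.
Proof.
move=> C3 CS /consecP[aC bC ab H]; apply/consecP => -[_ _ _ H'].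
have [c [cC ca cb]] := third_vertex a b C3.
by move: (H' c (subsetP CS _ cC)); rewrite arcN_rev // H.
Qed.

Lemma consec_sub C S a b : C \subset S -> a \in C -> b \in C ->
  consec S a b -> consec C a b.
Proof.
move=> CS aC bC /consecP[_ _ ab H]; apply/consecP; split=> // c cC.
exact: H (subsetP CS _ cC).
Qed.

(** The side over [y] joins the nearest vertices of [C] before and after [y]. *)
Lemma consec_gap C y : 1 < #|C| -> y \notin C -> exists a b, consec C a b /\ arc a b y.
Proof.
move=> C2 yC.
have /card_gt0P[x0 x0C] : 0 < #|C| by exact: ltnW.
pose back (x : 'I_N) := if x < y then y - x else y + N - x.
pose forth (x : 'I_N) := if x < y then x + N - y else x - y.
have [a aC amin] := arg_minnP back x0C.
have [b bC bmin] := arg_minnP forth x0C.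
have hy c : c \in C -> c != y :> nat.
  by move=> cC; apply: contraNneq yC => /val_inj <-.
have key c : c \in C -> (c == a) || ~~ arc a b c && ((a != b) && arc a b y).
  move=> cC; move: (amin c cC) (bmin c cC) (bmin a aC) (amin b bC).
  move: (hy a aC) (hy b bC) (hy c cC) (ltn_ord a) (ltn_ord b) (ltn_ord c) (ltn_ord y).
  rewrite /back /forth -!val_eqE /=.
  move=> ay bY cy aN bN cN yN h1 h2 h3 h4.
  exact: (arc_gap ay bY cy aN bN cN yN h1 h2 h3 h4).
have [c [cC ca]] : exists c, c \in C /\ c != a.
  have : 0 < #|C :\ a| by move: C2; rewrite (cardsD1 a); case: (a \in C); case: #|_ :\ a|.
  by case/card_gt0P => c; rewrite !inE => /andP[? ?]; exists c.
move: (key c cC); rewrite (negPf ca) /= => /and3P[_ ab aby].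
exists a, b; split=> //; apply/consecP; split=> // d dC.
by case/orP: (key d dC) => [/eqP ->|/andP[]//]; rewrite /arc !ltnn /= ltnNge; case: ltngtP.
Qed.

(* Polygons on arbitrary vertex subsets [S] of the N-gon, so that cutting an ear
   off needs no renumbering of the vertices. *)
Definition subside S a b := consec S a b || consec S b a.

Definition is_subcell S D C : bool :=
  [&& C \subset S, 3 <= #|C|,
      [forall a in C, forall b in C, consec C a b ==> (subside S a b || in_D D a b)] &
      [forall a in C, forall b in C,
         [&& a != b, ~~ consec C a b & ~~ consec C b a] ==> ~~ in_D D a b]].

Lemma subcellP S D C :
  reflect [/\ C \subset S, 3 <= #|C|,
     forall a b, consec C a b -> subside S a b || in_D D a b &
     forall a b, a \in C -> b \in C -> a != b -> in_D D a b -> consec C a b || consec C b a]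
  (is_subcell S D C).
Proof.
apply: (iffP and4P) => -[CS C3 H1 H2]; split => //.
- move=> a b ab; have /consecP[aC bC _ _] := ab.
  by move/forall_inP/(_ a aC)/forall_inP/(_ b bC)/implyP: H1; apply.
- move=> a b aC bC ab; apply: contraTT; rewrite negb_or => nn.
  move/forall_inP/(_ a aC)/forall_inP/(_ b bC)/implyP: H2; apply.
  by rewrite ab.
- by apply/forall_inP => a aC; apply/forall_inP => b bC; apply/implyP; apply: H1.
- apply/forall_inP => a aC; apply/forall_inP => b bC; apply/implyP => /and3P[ab n1 n2].
  by apply/negP => /(H2 a b aC bC ab); rewrite (negPf n1) (negPf n2).
Qed.

Definition subcells S D : {set {set 'I_N}} := [set C | is_subcell S D C].

Definition subdissection S D : Prop :=
  (forall p, p \in D -> [/\ p.1 \in S, p.2 \in S, p.1 < p.2 & ~~ subside S p.1 p.2]) /\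
  (forall p q, p \in D -> q \in D -> ~~ cross p q).

Definition subquiddity S D x := #|[set C in subcells S D | x \in C]|.

(** A cell missing a vertex of [S] would have a side passing over it, which is no side of [S] in
    either direction. *)
Lemma subcells0 S : 3 <= #|S| -> subcells S set0 = [set S].
Proof.
move=> S3; apply/setP => C; rewrite !inE; apply/subcellP/eqP => [[CS C3 H1 _]|->].
  apply/eqP; rewrite eqEsubset CS; apply/subsetP => y yS; apply/negPn/negP => yC.
  have [a [b [ab aby]]] := consec_gap (ltnW C3) yC.
  move: (H1 a b ab); rewrite /in_D !inE /= orbF /subside => /orP[/consecP[_ _ _ H]|].
    by move: (H y yS); rewrite aby.
  by apply/negP; apply: consec_opp CS ab.
split=> // a b; first by rewrite /subside => ->.
by rewrite /in_D !inE.
Qed.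

(** * Cutting off an ear *)

Section Ear.
Variables (S : {set 'I_N}) (D : {set 'I_N * 'I_N}) (i j : 'I_N).

Definition ear : {set 'I_N} := [set x in S | i <= x <= j].
Definition ear_compl : {set 'I_N} := [set x in S | ~~ (i < x < j)].

Hypotheses (iS : i \in S) (jS : j \in S).
(** Witnesses on the two sides of the chord from [i] to [j], making it a diagonal of [S]. *)
Variables (x0 o : 'I_N).
Hypotheses (x0S : x0 \in S) (x0E : i < x0 < j) (oS : o \in S) (oE : ~~ (i <= o <= j)).

Lemma ear_lt : i < j.
Proof. by case/andP: x0E; apply: ltn_trans. Qed.

Lemma ear_neq : i != j.
Proof. by rewrite neq_ord ltn_eqF ?ear_lt. Qed.

Lemma ear_compl_sub : ear_compl \subset S.
Proof. by apply/subsetP => x; rewrite inE => /andP[]. Qed.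

Lemma ear_compl_l : i \in ear_compl.
Proof. by rewrite inE iS ltnn. Qed.

Lemma ear_compl_r : j \in ear_compl.
Proof. by rewrite inE jS ltnn andbF. Qed.

Lemma consec_ear_compl a b : consec ear_compl a b -> consec S a b \/ a = i /\ b = j.
Proof.
move=> /consecP[aS bS ab H].
have [/existsP[c /andP[cS cab]]|nc] := boolP [exists c, (c \in S) && arc a b c]; last first.
  left; apply/consecP; split=> //; try exact: (subsetP ear_compl_sub).
  by move=> c cS; apply: contraNN nc => cab; apply/existsP; exists c; rewrite cS.
right; have hc : ~~ (c \in ear_compl) by apply: contraL cab; apply: H.
move: (H i ear_compl_l) (H j ear_compl_r) aS bS hc; rewrite !inE cS /= negbK.
move=> hi hj /andP[_ ha] /andP[_ hb] hc.
by have [/val_inj-> /val_inj->] := arc_over hc cab hi hj ha hb.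
Qed.

Lemma consec_ear_compl_base : consec ear_compl i j.
Proof.
apply/consecP; split; rewrite ?ear_compl_l ?ear_compl_r //.
  exact: ear_neq.
by move=> c; rewrite inE (arc_lt _ ear_lt) => /andP[_].
Qed.

Hypothesis dD : subdissection ear_compl D.

Lemma ear_diag_notin : (i, j) \notin D.
Proof.
by apply/negP => /dD.1[_ _ _]; rewrite /subside consec_ear_compl_base.
Qed.

Lemma ear_subdissection : subdissection S ((i, j) |: D).
Proof.
have ends q : q \in D -> ~~ (i < q.1 < j) && ~~ (i < q.2 < j) && (q.1 < q.2).
  by case/dD.1; rewrite !inE => /andP[_ ->] /andP[_ ->] ->.
split=> [p|p q]; rewrite !inE.
  case/predU1P => [-> /=|pD].
    split=> //; first exact: ear_lt.
    apply/negP => /orP[/consecP[_ _ _ /(_ x0 x0S)]|/consecP[_ _ _ /(_ o oS)]].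
      by rewrite (arc_lt _ ear_lt) x0E.
    by rewrite (arc_gt _ ear_lt) negb_or -!leqNgt andbC (negPf oE).
  have [p1 p2 lt ns] := dD.1 p pD.
  split=> //; try exact: (subsetP ear_compl_sub).
  by apply: contraNN ns => /orP[] /(consec_sub ear_compl_sub) H; rewrite /subside H ?orbT.
have key q' : q' \in D -> ~~ cross (i, j) q' && ~~ cross q' (i, j).
  move=> /ends; rewrite /cross /=; move: (nat_of_ord q'.1) (nat_of_ord q'.2) ear_lt.
  by move: (nat_of_ord i) (nat_of_ord j); clear; lia.
case/predU1P => [->|pD]; case/predU1P => [->|qD].
- by rewrite /cross /= !ltnn.
- by case/andP: (key q qD).
- by case/andP: (key p pD).
- exact: dD.2.
Qed.

Lemma in_ear_diag a b : in_D ((i, j) |: D) a b ->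
  [\/ a = i /\ b = j, a = j /\ b = i | in_D D a b].
Proof.
rewrite /in_D !inE -orbA => /or4P[/eqP[-> ->]|h|/eqP[-> ->]|h].
- by constructor 1.
- by constructor 3; rewrite h.
- by constructor 2.
- by constructor 3; rewrite h orbT.
Qed.

Lemma in_D_ends a b : in_D D a b -> [/\ a \in ear_compl, b \in ear_compl & a != b].
Proof.
rewrite neq_ord.
by case/orP => /dD.1[/= h1 h2 h3 _]; split=> //; rewrite neq_ltn h3 ?orbT.
Qed.

Lemma in_D_not_base a b : in_D D a b -> ~ (a = i /\ b = j) /\ ~ (a = j /\ b = i).
Proof.
move=> h; split=> -[ai bj]; move: h; rewrite ai bj /in_D (negPf ear_diag_notin) ?orbF /=.
  by move/dD.1 => [_ _ /=]; rewrite ltnNge ltnW ?ear_lt.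
by move/dD.1 => [_ _ /=]; rewrite ltnNge ltnW ?ear_lt.
Qed.

Lemma ear_is_subcell : is_subcell S ((i, j) |: D) ear.
Proof.
have sub : ear \subset S by apply/subsetP => x; rewrite inE => /andP[].
have iE : i \in ear by rewrite inE iS leqnn ltnW ?ear_lt.
have jE : j \in ear by rewrite inE jS leqnn andbT ltnW ?ear_lt.
have base : consec ear j i.
  apply/consecP; split=> //; first by rewrite eq_sym ear_neq.
  by move=> c; rewrite inE (arc_gt _ ear_lt) negb_or -!leqNgt => /andP[_]; rewrite andbC.
apply/subcellP; split=> //.
- have : [set i; j; x0] \subset ear.
    apply/subsetP => x; rewrite !inE => /orP[/orP[]|] /eqP ->.
    + by rewrite iS leqnn ltnW ?ear_lt.
    + by rewrite jS leqnn andbT ltnW ?ear_lt.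
    + by case/andP: x0E => h1 h2; rewrite x0S (ltnW h1) (ltnW h2).
  move/subset_leq_card; apply: leq_trans.
  case/andP: x0E => h1 h2; rewrite setUC cardsU1 cards2 !inE ear_neq negb_or !neq_ord.
  by rewrite (gtn_eqF h1) (ltn_eqF h2).
- move=> a b ab; have /consecP[] := ab; rewrite !inE => /andP[aS ha] /andP[bS hb] nab H.
  have [/existsP[c /andP[cS cab]]|nc] := boolP [exists c, (c \in S) && arc a b c]; last first.
    apply/orP; left; apply/orP; left; apply/consecP; split=> // c cS.
    by apply: contraNN nc => cab; apply/existsP; exists c; rewrite cS.
  have nE : ~~ (c \in ear) by apply: contraL cab; apply: H.
  move: nE (H i iE) (H j jE); rewrite inE cS /= => nE hi hj.
  have [/val_inj-> /val_inj->] := arc_outside ear_lt ha hb nE cab hi hj.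
  by rewrite /in_D !inE eqxx !orbT.
- move=> a b aE bE nab /in_ear_diag[[-> ->]|[-> ->]|h].
  + by rewrite base orbT.
  + by rewrite base.
  + have [n1 n2] := in_D_not_base h; have [] := in_D_ends h.
    move: aE bE nab; rewrite !inE !neq_ord => /andP[_ ha] /andP[_ hb] nab /andP[_ ha'] /andP[_ hb'] _.
    have ends (x : nat) : i <= x <= j -> ~~ (i < x < j) -> x = i \/ x = j.
      by move: (nat_of_ord i) (nat_of_ord j) => k l; clear; lia.
    case: (ends _ ha ha') => /val_inj ai; case: (ends _ hb hb') => /val_inj bi.
    * by move: nab; rewrite ai bi eqxx.
    * by case: n1.
    * by case: n2.
    * by move: nab; rewrite ai bi eqxx.
Qed.

(** A missing ear vertex would lie under a side of [C], and by [arc_avoid] so would [x]. Thus [C]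
    contains the ear, and the diagonal from [i] to [j] confines it there. *)
Lemma subcell_ear C x : is_subcell S ((i, j) |: D) C -> x \in C -> i < x < j -> C = ear.
Proof.
move=> /subcellP[CS C3 H1 H2] xC xE.
have earC : ear \subset C.
  apply/subsetP => y; rewrite inE => /andP[yS yE]; apply/negPn/negP => yC.
  have [a [b [ab aby]]] := consec_gap (ltnW C3) yC.
  have /consecP[aC bC nab nob] := ab.
  case/orP: (H1 a b ab) => [/orP[/consecP[_ _ _ H]|]|].
  - by move: (H y yS); rewrite aby.
  - by apply/negP; apply: consec_opp CS ab.
  - move: (nob x xC) aby => hx hy h.
    have [ha hb] : ~~ (i < a < j) /\ ~~ (i < b < j).
      case: (in_ear_diag h) => [[-> ->]|[-> ->]|/in_D_ends[]]; rewrite ?ltnn ?andbF //.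
      by rewrite !inE => /andP[_ ->] /andP[_ ->].
    by move: hx; rewrite (arc_avoid xE yE ha hb hy).
apply/eqP; rewrite eqEsubset earC andbT.
have iC : i \in C by apply: (subsetP earC); rewrite inE iS leqnn ltnW ?ear_lt.
have jC : j \in C by apply: (subsetP earC); rewrite inE jS leqnn andbT ltnW ?ear_lt.
have : in_D ((i, j) |: D) i j by rewrite /in_D !inE eqxx.
case/(H2 i j iC jC ear_neq)/orP => /consecP[_ _ _ H].
  by move: (H x xC); rewrite (arc_lt _ ear_lt) xE.
apply/subsetP => c cC; rewrite inE (subsetP CS c cC) /=.
by move: (H c cC); rewrite (arc_gt _ ear_lt) negb_or -!leqNgt andbC.
Qed.

(** A cell with no vertex strictly inside the ear lives in [ear_compl], where the cut is a side
    instead of a diagonal. *)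
Lemma ear_subcells : subcells S ((i, j) |: D) = ear |: subcells ear_compl D.
Proof.
apply/setP => C; rewrite in_setU1 !inE; apply/idP/predU1P => [HC|[->|]]; last 2 first.
- exact: ear_is_subcell.
- move=> /subcellP[CS C3 H1 H2]; apply/subcellP; split=> //.
  + exact: subset_trans CS ear_compl_sub.
  + move=> a b /H1 /orP[/orP[/consec_ear_compl[]|/consec_ear_compl[]]|].
    * by rewrite /subside => ->.
    * by move=> [-> ->]; rewrite /in_D !inE eqxx !orbT.
    * by rewrite /subside => ->; rewrite orbT.
    * by move=> [-> ->]; rewrite /in_D !inE eqxx !orbT.
    * by rewrite /in_D !inE => /orP[] ->; rewrite ?orbT.
  + move=> a b aC bC nab /in_ear_diag[[ai bj]|[aj bi]|]; last exact: H2.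
    * apply/orP; left; apply: (consec_sub CS) => //; rewrite ai bj; exact: consec_ear_compl_base.
    * apply/orP; right; apply: (consec_sub CS) => //; rewrite aj bi; exact: consec_ear_compl_base.
have [/existsP[x /andP[xC xE]]|nx] := boolP [exists x, (x \in C) && (i < x < j)].
  by left; apply: subcell_ear xC xE.
right; case/subcellP: HC => CS C3 H1 H2.
have CS' : C \subset ear_compl.
  apply/subsetP => x xC; rewrite inE (subsetP CS x xC) /=.
  by apply: contraNN nx => xE; apply/existsP; exists x; rewrite xC.
apply/subcellP; split=> //.
- move=> a b ab; have /consecP[aC bC _ _] := ab.
  have [aS bS] := (subsetP CS' _ aC, subsetP CS' _ bC).
  case/orP: (H1 a b ab) => [/orP[]|/in_ear_diag[[-> ->]|[-> ->]|->]].
  + by move/(consec_sub ear_compl_sub aS bS); rewrite /subside => ->.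
  + by move/(consec_sub ear_compl_sub bS aS); rewrite /subside => ->; rewrite orbT.
  + by rewrite /subside consec_ear_compl_base.
  + by rewrite /subside consec_ear_compl_base orbT.
  + by rewrite orbT.
- move=> a b aC bC nab h; apply: H2 => //.
  by case/orP: h => h; rewrite /in_D !inE h ?orbT.
Qed.

Lemma ear_notin : ear \notin subcells ear_compl D.
Proof.
rewrite inE; apply/subcellP => -[/subsetP/(_ x0)].
by case/andP: x0E => h1 h2; rewrite !inE x0S h1 h2 (ltnW h1) (ltnW h2) /= => /(_ isT).
Qed.

Lemma card_ear_subcells : #|subcells S ((i, j) |: D)| = #|subcells ear_compl D|.+1.
Proof. by rewrite ear_subcells cardsU1 ear_notin. Qed.

Lemma ear_subquiddity x :
  subquiddity S ((i, j) |: D) x = (x \in ear) + subquiddity ear_compl D x.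
Proof.
rewrite /subquiddity ear_subcells.
have [xE|xE] := boolP (x \in ear).
  rewrite (_ : [set C in _ | _] = ear |: [set C in subcells ear_compl D | x \in C]).
    by rewrite cardsU1 inE negb_and ear_notin.
  by apply/setP => C; rewrite !inE; case: eqP => [->|] //=; rewrite xE.
congr #|pred_of_set _|; apply/setP => C; rewrite !inE; case: eqP => [->|] //=.
by rewrite (negPf xE) !andbF.
Qed.

End Ear.

Lemma subquiddity_out S D x : x \notin S -> subquiddity S D x = 0.
Proof.
move=> xS; apply/eqP; rewrite cards_eq0; apply/eqP/setP => C; rewrite !inE.
apply/negP => /andP[/subcellP[/subsetP CS _ _ _] /CS]; exact/negP.
Qed.

End SubPolygons.

(** * Quiddities and sequences of ears *)

Lemma filter_none (T : Type) (P : pred T) s : all (predC P) s -> filter P s = [::].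
Proof. by elim: s => //= x s IH /andP[/negPf -> /IH]. Qed.

Lemma map_const_in (T : eqType) (T' : Type) (f : T -> T') c s :
  {in s, forall x, f x = c} -> map f s = nseq (size s) c.
Proof.
elim: s => //= x s IH H; rewrite H ?mem_head // IH // => y ys.
by rewrite H // inE ys orbT.
Qed.

Section Correspondence.
Variable N : nat.
Implicit Types (i j x y : 'I_N) (S : {set 'I_N}) (D : {set 'I_N * 'I_N}).

Lemma pairwise_enum S : pairwise (fun x y => x < y) (enum S).
Proof.
apply: (subseq_pairwise (filter_subseq _ _)).
rewrite -enumT -(pairwise_map val ltn) val_enum_ord.
by rewrite -sorted_pairwise ?iota_ltn_sorted //; apply: ltn_trans.
Qed.

Lemma enum_setIP S (P : pred 'I_N) : enum [set x in S | P x] = filter P (enum S).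
Proof.
by rewrite /enum_mem -filter_predI; apply: eq_filter => x; rewrite !inE andbC.
Qed.

(** As [enum] is increasing, the ear is a contiguous block. *)
Lemma enum_ear S i e j s1 s2 : enum S = s1 ++ i :: e ++ j :: s2 ->
  [/\ i < j, all (fun x => i < x < j) e, all (fun x => ~~ (i <= x <= j)) (s1 ++ s2),
      enum (ear_compl S i j) = s1 ++ i :: j :: s2 & #|ear S i j| = (size e).+2].
Proof.
move=> SE; have := pairwise_enum S; rewrite SE pairwise_cat /= pairwise_cat /= all_cat /=.
rewrite allrel_consr !allrel_catr !allrel_consr.
move=> /and3P[/and4P[s1i s1e s1j s1s2] _].
move=> /and5P[/and3P[ie ij is2] /andP[ej es2] _ js2 _].
have he : all (fun x => i < x < j) e.
  by apply/allP => x xe; rewrite (allP ie x xe) (allP ej x xe).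
have h1 x : x \in s1 -> x < i by move/(allP s1i).
have h2 x : x \in s2 -> j < x by move/(allP js2).
split=> //.
- rewrite all_cat; apply/andP; split; apply/allP => x.
    by move/h1 => xi; rewrite leqNgt xi.
  by move/h2 => jx; rewrite [x <= j]leqNgt jx andbF.
- rewrite /ear_compl enum_setIP SE !filter_cat /= filter_cat /= !ltnn andbF /=.
  have /all_filterP-> : all (fun x => ~~ (i < x < j)) s1.
    by apply/allP => x /h1 xi; rewrite ltnNge ltnW.
  have /all_filterP-> : all (fun x => ~~ (i < x < j)) s2.
    by apply/allP => x /h2 jx; rewrite [x < j]ltnNge (ltnW jx) andbF.
  by rewrite (filter_none (s := e)) //; apply: sub_all he => x /=; rewrite negbK.
- rewrite cardE /ear enum_setIP SE !filter_cat /= filter_cat /= !leqnn (ltnW ij) /=.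
  have /all_filterP-> : all (fun x => i <= x <= j) e.
    by apply: sub_all he => x /andP[ix xj]; rewrite (ltnW ix) (ltnW xj).
  rewrite (filter_none (s := s1)); last by apply/allP => x /h1 xi /=; rewrite leqNgt xi.
  rewrite (filter_none (s := s2)); last first.
    by apply/allP => x /h2 jx /=; rewrite [x <= j]leqNgt jx andbF.
  by rewrite /= size_cat /= addn1.
Qed.

(** Inner ear vertices lie in the new cell only and its two ends gain one cell, which is the pattern
    of [EarGlue]. *)
Lemma map_subquiddity_ear S D i e j s1 s2 x0 :
  x0 \in S -> i < x0 < j ->
  subdissection (ear_compl S i j) D -> enum S = s1 ++ i :: e ++ j :: s2 ->
  let q := subquiddity (ear_compl S i j) D in
  map (subquiddity S ((i, j) |: D)) (enum S) =
  map q s1 ++ (q i).+1 :: nseq (size e) 1 ++ (q j).+1 :: map q s2.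
Proof.
move=> x0S x0E dD SE q.
have [ij he] := enum_ear SE; rewrite all_cat => /andP[h1 h2] _ _.
have memS x : (x \in S) = (x \in s1 ++ i :: e ++ j :: s2) by rewrite -SE mem_enum.
have iS : i \in S by rewrite memS !(mem_cat, inE) eqxx orbT.
have jS : j \in S by rewrite memS !(mem_cat, inE) eqxx !orbT.
have E := ear_subquiddity iS jS x0S x0E dD.
have out x : ~~ (i <= x <= j) -> subquiddity S ((i, j) |: D) x = q x.
  by move=> /negPf h; rewrite E inE h andbF.
rewrite SE map_cat /= map_cat /=; congr (_ ++ _ :: _ ++ _ :: _).
- by apply/eq_in_map => x /(allP h1)/out.
- by rewrite E inE iS leqnn ltnW.
- apply: map_const_in => x xe; have /andP[ix xj] := allP he x xe.
  rewrite E inE memS !(mem_cat, inE) xe !orbT (ltnW ix) (ltnW xj) /=.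
  by rewrite subquiddity_out // inE ix xj andbF.
- by rewrite E inE jS leqnn andbT ltnW.
- by apply/eq_in_map => x /(allP h2)/out.
Qed.

Lemma three_in_set S x y z : x \in S -> y \in S -> z \in S -> x != y -> z != x -> z != y ->
  3 <= #|S|.
Proof.
move=> xS yS zS xy zx zy.
have : [set z; x; y] \subset S by rewrite !subUset !sub1set xS yS zS.
move/subset_leq_card; apply: leq_trans.
by rewrite -setUA cardsU1 cards2 !inE negb_or xy zx zy.
Qed.

Lemma not_consec_arc S x y : x \in S -> y \in S -> x != y -> ~~ consec S x y ->
  exists2 z, z \in S & arc x y z.
Proof.
move=> xS yS xy nc; have [/exists_inP //|ne] := boolP [exists z in S, arc x y z].
case/negP: nc; apply/consecP; split=> // c cS.
by apply: contraNN ne => h; apply/exists_inP; exists c.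
Qed.

(** A diagonal of least label difference cuts off an ear: one ending strictly inside would, being
    non-crossing, be nested and shorter. *)
Lemma subdissection_remove_ear S D i j : subdissection S D -> (i, j) \in D ->
  (forall p, p \in D -> j - i <= p.2 - p.1) ->
  subdissection (ear_compl S i j) (D :\ (i, j)) /\
  exists x0 o, [/\ x0 \in S, i < x0 < j, o \in S & ~~ (i <= o <= j)].
Proof.
move=> [dD nc] pD pmin; have [/= iS jS ij ns] := dD _ pD.
have nij : i != j by rewrite neq_ord ltn_eqF.
move: ns; rewrite negb_or => /andP[n1 n2].
have [x0 x0S] := not_consec_arc iS jS nij n1; rewrite (arc_lt _ ij) => x0E.
have nji : j != i by rewrite eq_sym.
have [o oS] := not_consec_arc jS iS nji n2; rewrite (arc_gt _ ij) => oE.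
have oE' : ~~ (i <= o <= j) by rewrite negb_and -!ltnNge orbC.
split; last by exists x0, o.
split=> [q|q r]; rewrite !inE => /andP[qp qD]; last by case/andP=> _; apply: nc.
have [q1 q2 q12 qs] := dD q qD.
have ins : ~~ (i < q.1 < j) /\ ~~ (i < q.2 < j).
  move: (nc _ _ pD qD) (pmin q qD) q12 ij; rewrite /cross /=.
  by move: (nat_of_ord i) (nat_of_ord j) (nat_of_ord q.1) (nat_of_ord q.2); clear; lia.
split=> //; rewrite ?inE ?q1 ?q2; [by case: ins|by case: ins|].
apply/negP => /orP[] /(consec_ear_compl iS jS) [h|[h1 h2]].
- by move: qs; rewrite /subside h.
- by move: qp; rewrite (surjective_pairing q) h1 h2 eqxx.
- by move: qs; rewrite /subside h orbT.
- by move: q12; rewrite h1 h2 ltnNge ltnW.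
Qed.

Lemma map_subquiddity0 S : 3 <= #|S| -> map (subquiddity S set0) (enum S) = nseq #|S| 1.
Proof.
move=> S3; rewrite cardE; apply: map_const_in => x; rewrite mem_enum => xS.
rewrite /subquiddity subcells0 // (_ : [set C in _ | _] = [set S]) ?cards1 //.
by apply/setP => C; rewrite !inE; case: eqP => // ->.
Qed.

(** Induction on the number of diagonals, removing a shortest one. *)
Lemma subdissection_ear_seq S D : 3 <= #|S| -> subdissection S D ->
  (forall C, C \in subcells S D -> 3 %| #|C|) ->
  ear_seq #|subcells S D| (map (subquiddity S D) (enum S)).
Proof.
have [n] := ubnP #|D|; elim: n S D => // n IH S D szD S3 dD per.
have [D0|[p0 p0D]] := set_0Vmem D.
  move: per; rewrite D0 subcells0 // cards1 => /(_ S (set11 S)) /dvdnP[k kE].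
  rewrite map_subquiddity0 //.
  case: k kE => [|k] kE; first by rewrite kE in S3.
  rewrite kE mulnC; exact: EarRoot.
have [[i j] pD pmin] := arg_minnP (fun p : 'I_N * 'I_N => p.2 - p.1) p0D.
have [dD' [x0 [o [x0S x0E oS oE]]]] := subdissection_remove_ear dD pD pmin.
have [/= iS jS ij _] := dD.1 _ pD.
have DE : D = (i, j) |: (D :\ (i, j)) by rewrite setD1K.
have [s1 [e [s2 SE]]] : exists s1 e s2, enum S = s1 ++ i :: e ++ j :: s2.
  have iE : i \in enum S by rewrite mem_enum.
  have jE : j \in enum S by rewrite mem_enum.
  have := pairwise_enum S; case/splitPr: iE jE => s1 t.
  rewrite mem_cat inE => /or3P[js1|/eqP ji|].
  - rewrite pairwise_cat allrel_consr => /and3P[/andP[/allP/(_ j js1) + _] _ _].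
    by rewrite /= ltnNge ltnW.
  - by move: ij; rewrite ji ltnn.
  - by move=> jt _; case/splitPr: jt => e s2; exists s1, e, s2.
have [_ _ _ S'E earE] := enum_ear SE.
have QE := map_subquiddity_ear x0S x0E dD' SE.
rewrite DE in per *; rewrite QE (card_ear_subcells iS jS x0S x0E dD').
have perE : 3 %| #|ear S i j|.
  by apply: per; rewrite (ear_subcells iS jS x0S x0E dD') setU11.
have [d eE] : exists d, size e = (3 * d).+1.
  by move: perE; rewrite earE; move: (size e) => t; clear; exists (t %/ 3); lia.
rewrite eE; apply: EarGlue.
set q := subquiddity _ _.
have -> : map q s1 ++ q i :: q j :: map q s2 = map q (enum (ear_compl S i j)).
  by rewrite S'E map_cat.
apply: IH => //.
- by move: szD; rewrite (cardsD1 (i, j)) (pD : (i, j) \in D).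
- apply: (three_in_set (ear_compl_l j iS) (ear_compl_r i jS) (_ : o \in _)).
  + rewrite inE oS; apply: contraNN oE => /andP[io oj]; by rewrite (ltnW io) (ltnW oj).
  + by rewrite neq_ord ltn_eqF.
  + by apply: contraNneq oE => ->; rewrite leqnn ltnW.
  + by apply: contraNneq oE => ->; rewrite leqnn ltnW.
- by move=> C CE; apply: per; rewrite (ear_subcells iS jS x0S x0E dD') setU1r.
Qed.

(** The gluings are replayed on an arbitrary vertex set, so that the induction hypothesis applies to
    [ear_compl]. *)
Lemma ear_seq_subdissection k s S : ear_seq k s -> #|S| = size s -> exists D,
  [/\ subdissection S D, forall C, C \in subcells S D -> 3 %| #|C|,
      #|subcells S D| = k & map (subquiddity S D) (enum S) = s].
Proof.
move=> ks; elim: ks S => [d|{}k d s1 a b s2 H IH] S szS.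
  move: szS; rewrite size_nseq => szS.
  have S3 : 3 <= #|S| by rewrite szS; lia.
  exists set0; rewrite subcells0 // cards1; split=> //.
  - by split=> [p|p q]; rewrite inE.
  - by move=> C /set1P ->; rewrite szS dvdn_mulr.
  - by rewrite map_subquiddity0 // szS.
have [t1 [i [e [j [t2 [SE sz1 sze]]]]]] : exists t1 i e j t2,
    [/\ enum S = t1 ++ i :: e ++ j :: t2, size t1 = size s1 & size e = (3 * d).+1].
  move: szS; rewrite cardE size_cat /= size_cat /= size_nseq => szS.
  exists (take (size s1) (enum S)).
  have := cat_take_drop (size s1) (enum S).
  have := size_drop (size s1) (enum S).
  case: (drop _ _) => [|i t] /= st tE; first by lia.
  exists i, (take (3 * d).+1 t).
  have := cat_take_drop (3 * d).+1 t.
  have := size_drop (3 * d).+1 t.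
  case: (drop _ _) => [|j t2] /= st2 t2E; first by lia.
  exists j, t2; split; first by rewrite t2E tE.
    by rewrite size_takel //; lia.
  by rewrite size_takel //; lia.
have [ij he hout S'E earE] := enum_ear SE.
have memS x : (x \in S) = (x \in t1 ++ i :: e ++ j :: t2) by rewrite -SE mem_enum.
have iS : i \in S by rewrite memS !(mem_cat, inE) eqxx orbT.
have jS : j \in S by rewrite memS !(mem_cat, inE) eqxx !orbT.
have [x0 [x0S x0E]] : exists x0, x0 \in S /\ i < x0 < j.
  case: (e) sze he SE => // x0 e' _ /= /andP[x0E _] SE; exists x0; split=> //.
  by rewrite -mem_enum SE !(mem_cat, inE) eqxx !orbT.
(* Before the gluing there were at least three entries, so one besides the two ends remains. *)
have [o [oS oE]] : exists o, o \in S /\ ~~ (i <= o <= j).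
  have : 0 < size (t1 ++ t2).
    move: szS (ear_seq_size H); rewrite cardE SE !size_cat /= !size_cat /= size_nseq sze sz1.
    by clear; lia.
  case: (t1 ++ t2) hout (fun x => mem_cat x t1 t2) => // o t /= /andP[oE _] /(_ o) om _.
  exists o; split=> //; rewrite memS !(mem_cat, inE).
  by move: om; rewrite mem_head => /esym/orP[] ->; rewrite ?orbT.
have [|D [dD per cardD QD]] := IH (ear_compl S i j).
  move: szS; rewrite !cardE S'E SE !size_cat /= !size_cat /= size_nseq sze sz1; clear; lia.
exists ((i, j) |: D); split.
- exact: (ear_subdissection iS jS x0S x0E oS oE dD).
- move=> C; rewrite (ear_subcells iS jS x0S x0E dD) => /setU1P[->|]; last exact: per.
  by rewrite earE sze; clear; lia.
- by rewrite (card_ear_subcells iS jS x0S x0E dD) cardD.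
- rewrite (map_subquiddity_ear x0S x0E dD SE) sze.
  move: QD; rewrite S'E map_cat /= => /eqP.
  by rewrite eqseq_cat ?size_map // !eqseq_cons => /and4P[/eqP-> /eqP-> /eqP-> /eqP->].
Qed.

(** * Comparison with the definitions on the whole polygon *)

Hypothesis N2 : 1 < N.

Lemma sideE (x y : 'I_N) : side x y = subside setT x y.
Proof.
have H (a b : 'I_N) : consec setT a b = (nat_of_ord b == a.+1 %% N).
  have mE : a.+1 %% N = if a.+1 == N then 0 else a.+1.
    case: eqP => [->|/eqP ne]; first by rewrite modnn.
    by rewrite modn_small // ltn_neqAle ne ltn_ord.
  apply/consecP/eqP => [[_ _ nab h]|bE].
    have cN : a.+1 %% N < N by rewrite ltn_mod ltnW.
    have := h (Ordinal cN) (in_setT _); move: nab; rewrite neq_ord /= mE.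
    case: (a.+1 =P N) => aN; move: (ltn_ord a) (ltn_ord b) N2; clear -aN.
      by case: (ltngtP a b) => // ab; [rewrite (arc_lt _ ab)|rewrite (arc_gt _ ab)]; lia.
    by case: (ltngtP a b) => // ab; [rewrite (arc_lt _ ab)|rewrite (arc_gt _ ab)]; lia.
  have nab : a != b :> nat by rewrite bE mE; move: N2; case: (a.+1 =P N); clear; lia.
  split; rewrite ?in_setT // => c _; move: nab (ltn_ord c); rewrite bE mE.
  case: (a.+1 =P N) => aN nab cN.
    by rewrite arc_gt; lia.
  by rewrite arc_lt; lia.
by rewrite /subside !H.
Qed.

Lemma cellsE D : cells D = subcells setT D.
Proof.
apply/setP => C; rewrite !inE /is_cell /is_subcell subsetT /=; congr [&& _, _ & _].
apply: eq_forallb => a; congr (_ ==> _); apply: eq_forallb => b.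
by rewrite sideE.
Qed.

Lemma is_dissectionP D : reflect (subdissection setT D) (is_dissection D).
Proof.
apply: (iffP andP) => [[/forall_inP h1 /forall_inP h2]|[h1 h2]]; split.
- by move=> p pD; rewrite !in_setT; case/andP: (h1 p pD) => ?; rewrite sideE.
- by move=> p q pD qD; move/forall_inP: (h2 p pD); apply.
- by apply/forall_inP => p /h1[_ _ h]; rewrite /is_diag h sideE.
- by apply/forall_inP => p pD; apply/forall_inP => q; apply: h2.
Qed.

Lemma quiddityE D : quiddity D = map (subquiddity setT D) (enum [set: 'I_N]).
Proof.
rewrite /quiddity (eq_enum (in_setT (T := 'I_N)) : enum [set: 'I_N] = enum 'I_N).
by apply: eq_map => x; rewrite /subquiddity cellsE.
Qed.

End Correspondence.

(** * Quiddities counted by closed walks *)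

Lemma Q_closed_count n m : 0 < n -> Q n m.+1 = closed_count n m.
Proof.
move=> n0; rewrite /Q /closed_count.
set qs := [seq quiddity D | D <- _].
have N2 : 1 < n.+2 by [].
have qsP s : reflect (ear_seq m.+1 s /\ size s = n.+2) (s \in qs).
  apply: (iffP mapP) => [[D]|[es sz]].
    rewrite mem_enum inE => /and3P[/(is_dissectionP N2) dD /forall_inP per /eqP card] ->.
    split; last by rewrite /quiddity size_map size_enum_ord.
    rewrite quiddityE // -card cellsE //; apply: subdissection_ear_seq => //.
      by rewrite cardsT card_ord.
    by move=> C; rewrite -cellsE //; apply: per.
  have [|D [dD per card QD]] := ear_seq_subdissection (S := [set: 'I_n.+2]) es.
    by rewrite cardsT card_ord.
  exists D; last by rewrite quiddityE.
  rewrite mem_enum inE; apply/and3P; split; first exact/(is_dissectionP N2).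
    by apply/forall_inP => C; rewrite cellsE //; apply: per.
  by rewrite cellsE // card.
have wordE s : s \in qs -> word s = true :: behead (word s).
  by case/qsP; case: s.
(* The initial V is dropped because [closed_count] starts after it; decoding the full word gives
   injectivity. *)
have inj : {in undup qs &, injective (behead \o word)}.
  move=> s t; rewrite !mem_undup => sq tq /= E.
  have [[/ear_seq_pos sp _] [/ear_seq_pos tp _]] := (qsP _ sq, qsP _ tq).
  have [] // : (0, s) = (0, t).
  by rewrite -(wordK sp) -(wordK tp) (wordE s sq) E -(wordE t tq).
rewrite -(size_map (behead \o word)); apply: perm_size; apply: uniq_perm.
- by rewrite map_inj_in_uniq // undup_uniq.
- exact: closing_uniq.
move=> w; rewrite closingP //; apply/mapP/and3P => [[s]|[/eqP c1 /eqP c2 /eqP cr]].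
  rewrite mem_undup => sq ->; have [es sz] := qsP _ sq.
  have [c1 c2] := count_word (ear_seq_pos es).
  have := sumn_ear_seq es; have := ear_seq_run es; move: c1 c2.
  rewrite (wordE s sq) /= sz => c1 c2 /= cr sE.
  by split; [apply/eqP; lia|apply/eqP; lia|apply/eqP].
(* With the initial V restored, [w] decodes to an ear sequence, whose length and number of cells are
   fixed by the letter counts. *)
have [k es] := @run_ear_seq (true :: w) isT cr.
have wE := @word_unword (true :: w) isT.
move: (unword (true :: w)).2 es wE => s es wE.
exists s; last exact: (esym (congr1 behead wE)).
rewrite mem_undup; apply/qsP.
have [] := count_word (ear_seq_pos es); rewrite wE /= c1 c2 => e1 e2.
have := sumn_ear_seq es => e3.
have <- : k = m.+1 by lia.
by split=> //; lia.
Qed.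

Theorem mainTheorem1 (n m : nat) (hn : 1 <= n) (hm : 1 <= m) :
  (n != m %[mod 3] -> Q n m = 0) /\
  (n = m %[mod 3] ->
     ((Q n m)%:R =
       \sum_(0 <= s < n.+1 | (m + 3 * s <= n)%N)
         ((n - m - 3 * s + 2)%N%:R / (n - s + 1)%N%:R
          * ('C(m + s - 2, s))%:R * ('C(n + m - s - 1, m - 1))%:R) :> rat)%R).
Proof.
case: m hm => // m _; rewrite Q_closed_count //.
by split; [apply: closed_count0 | apply: closed_countE].
Qed.
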